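(* Let $n \geq 3$ be an integer. Then the number of equivalence classes of $C_n$ under $\equiv_E$ is \[ |C_n/\!\equiv_E| = \frac{1}{2n^2}\left[\sum_{d\mid n}\left(\phi\!\left(\frac{n}{d}\right)\right)^2\left(\frac{n}{d}\right)^d d! + \begin{cases} \frac{n}{2}\, n!!, & \text{if $n$ is even;}\\ 0, & \text{if $n$ is odd.}\end{cases}\right] \]
   Context: Identify the vertices of the complete graph $K_n$ with $n$ regularly spaced points on a circle, labelled $0,1,\dots,n-1$ in cyclic order (the geometric realization); edges are drawn as line segments. $C_n$ denotes the set of subgraphs of $K_n$ induced by Hamiltonian cycles: the subgraph has all $n$ vertices and exactly the edges traversed by the cycle. Two subgraphs $G_1,G_2$ are equivalent, $G_1 \equiv_E G_2$, if one is obtained from the other by a rotation (not a reflection) of the regular $n$-gon of vertices, i.e. by applying to the vertex labels a map $x \mapsto x + k \pmod n$. $\phi$ is Euler's totient function, the sum is over positive divisors $d$ of $n$, and for a positive integer $m$, $m!!$ denotes the product of $m$ with all positive integers less than $m$ of the same parity as $m$. *)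

(* Defs.v *)
From mathcomp Require Export all_boot all_order all_algebra.

Set Implicit Arguments.
Unset Strict Implicit.
Unset Printing Implicit Defensive.

Definition Kn n : rel 'I_n := [rel x y | x != y].

(* A subgraph of K_n is a pair (vertex set, edge set), an edge being the
   unordered pair [set x; y] of its endpoints. *)
Definition subgraph n : finType := ({set 'I_n} * {set {set 'I_n}})%type.

Definition cycle_subgraph n (s : seq 'I_n) : subgraph n :=
  ([set x in s], [set [set x; next s x] | x in s]).

(* A Hamiltonian cycle is listed as the n-tuple of its successive vertices,
   read cyclically: the last vertex is joined back to the first. *)
Definition hamiltonian_cycle n (s : n.-tuple 'I_n) : bool :=
  ucycleb (@Kn n) s && [forall x : 'I_n, x \in s].

Definition hamiltonian_subgraphs n : {set subgraph n} :=
  [set cycle_subgraph s | s : n.-tuple 'I_n & hamiltonian_cycle s].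

Lemma rotv_subproof n (k : nat) (x : 'I_n) : (x + k) %% n < n.
Proof. by apply: ltn_pmod; apply: leq_ltn_trans (ltn_ord x). Qed.

Definition rotv n (k : nat) (x : 'I_n) : 'I_n := Ordinal (rotv_subproof k x).

Definition rot_subgraph n (k : nat) (G : subgraph n) : subgraph n :=
  (rotv k @: G.1, [set rotv k @: e | e : {set 'I_n} in G.2]).

Definition rot_equiv n : rel (subgraph n) :=
  [rel G1 G2 | [exists k : 'I_n, G2 == rot_subgraph k G1]].

Lemma rotvD n k l (x : 'I_n) : rotv l (rotv k x) = rotv (k + l) x.
Proof. by apply: val_inj; rewrite /= modnDml addnA. Qed.

Lemma rotv_mod n k (x : 'I_n) : rotv (k %% n) x = rotv k x.
Proof. by apply: val_inj; rewrite /= modnDmr. Qed.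

Lemma rotv_n n (x : 'I_n) : rotv n x = x.
Proof. by apply: val_inj; rewrite /= modnDr modn_small. Qed.

Lemma rot_subgraphD n k l (G : subgraph n) :
  rot_subgraph l (rot_subgraph k G) = rot_subgraph (k + l) G.
Proof.
have rotD (A : {set _}) : rotv l @: (rotv k @: A) = @rotv n (k + l) @: A.
  by rewrite -imset_comp; apply: eq_imset => x /=; rewrite rotvD.
rewrite /rot_subgraph /= rotD; congr pair.
by rewrite -imset_comp; apply: eq_imset => e /=; rewrite rotD.
Qed.

Lemma eq_rot_subgraph n k l (G : subgraph n) :
  @rotv n k =1 rotv l -> rot_subgraph k G = rot_subgraph l G.
Proof.
move=> kl; rewrite /rot_subgraph (eq_imset _ kl); congr pair.
by apply: eq_imset => e; apply: eq_imset.
Qed.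

Lemma rot_subgraph_n n (G : subgraph n) : rot_subgraph n G = G.
Proof.
have rot_id (A : {set _}) : @rotv n n @: A = A.
  by rewrite -[RHS]imset_id; apply: eq_imset; exact: rotv_n.
case: G => V E; rewrite /rot_subgraph /= rot_id; congr pair.
by rewrite -[RHS]imset_id; apply: eq_imset; exact: rot_id.
Qed.

Lemma rot_equivP n (G1 G2 : subgraph n) : 0 < n ->
  reflect (exists k : nat, G2 = rot_subgraph k G1) (rot_equiv G1 G2).
Proof.
move=> n0; apply: (iffP existsP) => [[k /eqP->]|[k ->]]; first by exists k.
exists (Ordinal (ltn_pmod k n0)); apply/eqP/eq_rot_subgraph => x /=.
by rewrite rotv_mod.
Qed.

Lemma rot_equiv_equivalence n : 0 < n -> equivalence_rel (@rot_equiv n).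
Proof.
move=> n0.
have sym (G H : subgraph n) : rot_equiv G H -> rot_equiv H G.
  case/existsP=> k /eqP->; apply/rot_equivP => //; exists (n - k).
  by rewrite rot_subgraphD subnKC ?rot_subgraph_n // ltnW.
have trans (F G H : subgraph n) :
    rot_equiv F G -> rot_equiv G H -> rot_equiv F H.
  case/rot_equivP=> // k -> /rot_equivP[//|l ->].
  by apply/rot_equivP => //; exists (k + l); rewrite rot_subgraphD.
move=> F G H; split; first by apply/rot_equivP => //; exists n; rewrite rot_subgraph_n.
by move=> FG; apply/idP/idP; apply: trans => //; exact: sym.
Qed.

Definition double_factorial (m : nat) : nat :=
  \prod_(1 <= i < m.+1 | odd i == odd m) i.

(* Main.v *)
(** Listing the vertices of a Hamiltonian cycle identifies [C_n] with ['S_n]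
    modulo the dihedral group [D] acting on positions: an adjacency-preserving
    bijection of the [n]-cycle moves by a step [+1] or [-1] at each position,
    and injectivity forces the sign to be constant. The rotation classes are
    thus the orbits of [D * C] on ['S_n] for [s |-> a^-1 s b], where [C] is the
    group of rotations, and Burnside's lemma reduces the count to the numbers
    of [s] with [a s = s b].

    If all cycles of [a] and [b] have the same length [m], such an [s] is
    determined by the images of one point in each of the [d = n / m] cycles of
    [a], which must lie in distinct cycles of [b]: this gives [m ^ d * d!]. If
    the orders differ there is no such [s]. Two rotations by [j] and [k] match
    when [gcd(n, j) = gcd(n, k)]; a reflection matches a rotation only if it has
    no fixed point and the rotation is by [n / 2]. *)
Require Import Defs.
From mathcomp Require Import all_boot all_order all_algebra all_fingroup.
From mathcomp Require Import zify.
Import GRing.Theory.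

Set Implicit Arguments.
Unset Strict Implicit.
Unset Printing Implicit Defensive.

Local Notation forder := fingraph.order.

(** * Permutations intertwining two maps, and their number when all orbits have the same length *)

Section Intertwiners.

Variable T : finType.
Implicit Types f g : T -> T.

Definition intertwiners f g : {set {perm T}} :=
  [set s : {perm T} | [forall x, s (f x) == g (s x)]].

Lemma intertwinersP f g (s : {perm T}) :
  reflect (forall x, s (f x) = g (s x)) (s \in intertwiners f g).
Proof. by rewrite inE; apply: (iffP forallP) => fgs x; apply/eqP. Qed.

Lemma intertwiner_iter f g (s : {perm T}) k x :
  s \in intertwiners f g -> s (iter k f x) = iter k g (s x).
Proof. by move/intertwinersP=> fgs; elim: k => //= k <-. Qed.

Lemma iter_mod_order f k x :
  injective f -> iter (k %% forder f x) f x = iter k f x.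
Proof.
move=> injf; rewrite {2}(divn_eq k (forder f x)) addnC iterD; congr (iter _ f _).
by elim: (k %/ _) => //= q IHq; rewrite mulSn iterD -IHq iter_order.
Qed.

Lemma eq_iter_mod_order f i j x : injective f ->
  (iter i f x == iter j f x) = (i == j %[mod forder f x]).
Proof.
move=> injf; apply/eqP/eqP => [|eq_ij].
  rewrite -(iter_mod_order i) // -(iter_mod_order j) // => /(congr1 (findex f x)).
  by rewrite !findex_iter ?ltn_pmod ?order_gt0.
by rewrite -(iter_mod_order i) // -(iter_mod_order j) // eq_ij.
Qed.

Lemma iter_eq_id f k x : injective f -> (iter k f x == x) = (forder f x %| k).
Proof. by move=> injf; rewrite (eq_iter_mod_order k 0) // mod0n. Qed.

(** An iterate of [f] fixes [x] exactly when the same iterate of [g] fixes [s x], so each order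
    divides the other. *)
Lemma order_intertwiner f g (s : {perm T}) x : injective f -> injective g ->
  s \in intertwiners f g -> forder g (s x) = forder f x.
Proof.
move=> injf injg sP; apply/eqP; rewrite eqn_dvd -!iter_eq_id //.
rewrite -(intertwiner_iter _ _ sP) iter_order // eqxx -(inj_eq (@perm_inj _ s)).
by rewrite (intertwiner_iter _ _ sP) iter_order ?eqxx.
Qed.

Section Semiregular.

Variables (f g : T -> T) (m : nat).
Hypotheses (injf : injective f) (injg : injective g).
Hypotheses (ordf : forall x, forder f x = m) (ordg : forall x, forder g x = m).

Let D : finType := {x : T | x \in froots f}.

(* An intertwiner is determined by its values on one representative of each
   [f]-orbit, and these values must lie in distinct [g]-orbits. *)
Let codes := [set h : {ffun D -> T} | injectiveb [ffun i => froot g (h i)]].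

Lemma card_froots (h : T -> T) : injective h -> (forall x, forder h x = m) ->
  #|froots h| * m = #|T|.
Proof.
move=> injh ordh; rewrite -(@fcard_order_set _ h injh m predT).
- by congr (_ * _); apply: eq_card => x; rewrite !inE andbT.
- by apply/subsetP=> x _; rewrite !inE ordh.
- by [].
Qed.

Lemma card_froots_div (h : T -> T) : injective h -> (forall x, forder h x = m) ->
  0 < #|T| -> #|froots h| = #|T| %/ m.
Proof.
move=> injh ordh; rewrite -(card_froots injh ordh) muln_gt0 => /andP[_ m0].
by rewrite mulnK.
Qed.

(** Codes are grouped by the map of roots they induce. That map is an injection between two sets of
    size [#|T| %/ m], and over each such map every value ranges freely over a [g]-orbit of [m]
    points. *)
Lemma card_codes : 0 < #|T| ->
  #|codes| = (m ^ (#|T| %/ m) * (#|T| %/ m)`!)%N.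
Proof.
move=> T0; have cardD : #|D| = #|T| %/ m.
  by rewrite -(card_froots_div injf) // card_sig.
pose pr (h : {ffun D -> T}) : {ffun D -> T} := [ffun i => froot g (h i)].
pose B := [set h : {ffun D -> T} in ffun_on (froots g) | injectiveb h].
have cardB : #|B| = (#|T| %/ m)`!.
  by rewrite card_inj_ffuns_on cardD (card_froots_div injg) // ffactnn.
rewrite -sum1_card (partition_big pr (mem B)) /=; last first.
  move=> h; rewrite !inE => ->; rewrite andbT; apply/ffun_onP => i.
  by rewrite ffunE; apply: roots_root; apply: fconnect_sym.
rewrite mulnC -cardB -sum_nat_const; apply: eq_bigr => h.
rewrite inE => /andP[/ffun_onP hroot hinj].
pose F i := [pred y | froot g y == h i].
rewrite sum1dep_card (@eq_card _ _ (family F)).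
  rewrite card_family foldrE big_image -cardD -prod_nat_const.
  apply: eq_bigr => i _; rewrite -(ordg (h i)); apply: eq_card => y.
  have /eqP hr : froots g (h i) := hroot i.
  have symg := fconnect_sym injg.
  by rewrite !inE -{1}hr (root_connect symg) symg.
move=> k; rewrite !inE; apply/andP/familyP => [[_ /eqP/ffunP eq_h] i|kF].
  by rewrite inE -(eq_h i) ffunE.
have eq_h : pr k = h by apply/ffunP => i; rewrite ffunE; apply/eqP/kF.
by split; [move: hinj; rewrite -eq_h | rewrite eq_h].
Qed.

(** Restriction to the roots of [f] is a bijection from intertwiners to codes; its inverse extends a
    code along the orbits. *)
Lemma card_intertwiners : 0 < #|T| ->
  #|intertwiners f g| = (m ^ (#|T| %/ m) * (#|T| %/ m)`!)%N.
Proof.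
move=> T0; rewrite -card_codes //.
have symf := fconnect_sym injf; have symg := fconnect_sym injg.
have rootD x : froot f x \in froots f by apply: roots_root.
pose rep x : D := exist _ (froot f x) (rootD x).
pose pos x := findex f (froot f x) x.
have posK x : iter (pos x) f (val (rep x)) = x.
  by apply: iter_findex; rewrite symf connect_root.
have repI k (i : D) : rep (iter k f (val i)) = i.
  apply: val_inj; rewrite /= -[RHS](eqP (valP i : roots _ _)).
  by apply/esym/(fingraph.rootP symf)/fconnect_iter.
pose code (s : {perm T}) : {ffun D -> T} := [ffun i => s (val i)].
rewrite -(@card_in_imset _ _ code) => [|s t sP tP eq_st]; last first.
  apply/permP => x; rewrite -(posK x) !(intertwiner_iter (f := f) (g := g)) //.
  by congr iter; move/ffunP/(_ (rep x)): eq_st; rewrite !ffunE.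
apply: eq_card => h; apply/imsetP/idP => [[s sP ->]|].
  rewrite inE; apply/injectiveP => i j; rewrite !ffunE.
  move/(fingraph.rootP symg)/iter_findex; rewrite -(intertwiner_iter _ _ sP).
  by move/perm_inj/(congr1 rep); rewrite repI (repI 0).
rewrite inE => /injectiveP injh.
(* [F] takes as many [g]-steps from the coded value as there are [f]-steps from the root to [x]. *)
pose F x := iter (pos x) g (h (rep x)).
(* Any step count [k] leading to the point will do: it agrees with [pos] modulo the common order [m]
   of [f] and [g]. *)
have iterF k (i : D) : F (iter k f (val i)) = iter k g (h i).
  rewrite /F repI; apply/eqP; rewrite eq_iter_mod_order // ordg.
  rewrite -(ordf (val i)) -eq_iter_mod_order //.
  by rewrite -[X in iter _ f (val X)](repI k) posK.
(* Equal values share a [g]-orbit, so the roots agree by injectivity of the code, and then the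
   positions agree modulo [m]. *)
have injF : injective F.
  move=> x y; rewrite /F => eqF.
  have eq_rep : rep x = rep y.
    apply: injh; rewrite !ffunE; apply/(fingraph.rootP symg).
    apply: connect_trans (fconnect_iter g (pos x) _) _.
    by rewrite eqF symg fconnect_iter.
  move/eqP: eqF; rewrite eq_rep eq_iter_mod_order // ordg -(ordf (val (rep y))).
  by rewrite -eq_iter_mod_order // posK -eq_rep posK => /eqP.
exists (perm injF).
  apply/intertwinersP => x; rewrite !permE -[x]posK.
  by rewrite -iterS !iterF.
by apply/ffunP => i; rewrite ffunE permE; apply/esym/(iterF 0).
Qed.


End Semiregular.
End Intertwiners.

(** * Arithmetic of gcd classes and of the double factorial *)

Lemma dvdn_mul_gcd n k i : 0 < n -> (n %| k * i) = (n %/ gcdn n k %| i).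
Proof.
move=> n0; have g0 : 0 < gcdn n k by rewrite gcdn_gt0 n0.
have gn := dvdn_gcdl n k; have gk := dvdn_gcdr n k.
rewrite -[X in X %| _](divnK gn) -[X in _ %| X * _](divnK gk) mulnAC.
rewrite dvdn_pmul2r // Gauss_dvdr //.
by rewrite /coprime -(eqn_pmul2r g0) mul1n muln_gcdl !divnK.
Qed.

(** Multiplication by [d] carries the residues coprime to [n %/ d] bijectively onto this set. *)
Lemma card_gcdn_eq n d : 0 < n -> d %| n ->
  #|[set k : 'I_n | gcdn n k == d]| = totient (n %/ d).
Proof.
move=> n0 dn; have d0 := dvdn_gt0 n0 dn.
set m := n %/ d; have nE : n = m * d by rewrite divnK.
rewrite totient_count_coprime big_mkord -big_mkcond /= sum1dep_card.
have ltP (i : 'I_m) : i * d < n by rewrite nE ltn_pmul2r.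
pose h (i : 'I_m) : 'I_n := Ordinal (ltP i).
rewrite -(@card_imset _ _ h) => [|i i' /(congr1 val)/eqP]; last first.
  by rewrite /= eqn_pmul2r // => /eqP/val_inj.
apply/eq_card => k; rewrite inE; apply/eqP/imsetP => [gk|[i]].
  have dk : d %| k by rewrite -gk dvdn_gcdr.
  have ltkd : k %/ d < m by rewrite -(ltn_pmul2r d0) divnK // -nE.
  exists (Ordinal ltkd); last by apply: val_inj; rewrite /= divnK.
  rewrite inE /coprime -(eqn_pmul2r d0) /= muln_gcdl divnK // -nE gk.
  by rewrite mul1n.
by rewrite inE => /eqP cop ->; rewrite /= {1}nE -muln_gcdl cop mul1n.
Qed.

Lemma card_odd_ord n : ~~ odd n -> #|[set j : 'I_n | odd j]| = n./2.
Proof.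
move=> evn; rewrite -sum1dep_card -(big_mkord odd (fun=> 1)).
rewrite -{1}(even_halfK evn) big_mkcond.
elim: n./2 => [|m IHm]; first by rewrite big_geq.
by rewrite doubleS !big_nat_recr //= IHm odd_double addn0 addn1.
Qed.

(** Each of the n/2 even factors gives up a 2; the result has the shape m^d d! with m = 2. *)
Lemma double_factorial_even n : ~~ odd n ->
  double_factorial n = (2 ^ n./2 * (n./2)`!)%N.
Proof.
move=> evn; rewrite /double_factorial (negPf evn).
rewrite -{1}(even_halfK evn) big_mkcond.
elim: n./2 => [|m IHm]; first by rewrite big_geq.
rewrite doubleS 2?big_nat_recr // IHm /= odd_double /=.
by rewrite muln1 expnS factS -addnn; lia.
Qed.

(** * Rotations and reflections of Z/n and their intertwiners *)

Section Translations.

Variable p : nat.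
(** With n of the form [p.+3], ['I_n] is the ring Z/n and 1 differs from -1. *)
Local Notation n := p.+3.
Local Open Scope ring_scope.
Implicit Types j k x : 'I_n.

Definition shift k x : 'I_n := x + k.
Definition flip j x : 'I_n := j - x.

Lemma shift_inj k : injective (shift k). Proof. exact: addIr. Qed.
Lemma flip_inj j : injective (flip j).
Proof. by move=> x y /addrI/oppr_inj. Qed.

Lemma iter_shift k i x : iter i (shift k) x = x + k *+ i.
Proof. by elim: i => [|i IHi] /=; rewrite ?addr0 // IHi mulrSr addrA. Qed.

Lemma order_shift k x : forder (shift k) x = (n %/ gcdn n k)%N.
Proof.
have ordE i : (forder (shift k) x %| i)%N = (n %/ gcdn n k %| i)%N.
  rewrite -(iter_eq_id i x (@shift_inj k)) iter_shift -{2}[x]addr0.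
  rewrite (inj_eq (addrI x)) -dvdn_mul_gcd // Zp_mulrn.
  by rewrite -val_eqE.
by apply/eqP; rewrite eqn_dvd ordE dvdnn -ordE dvdnn.
Qed.

Lemma flipK j : involutive (flip j).
Proof. by move=> x; rewrite /flip opprB addrCA subrr addr0. Qed.

Lemma order_flip j x : forder (flip j) x = if flip j x == x then 1%N else 2%N.
Proof.
have := iter_eq_id 1 x (@flip_inj j); have := iter_eq_id 2 x (@flip_inj j).
rewrite /= flipK eqxx dvdn1 => /esym d2 ->.
move: d2; case: eqP => [->//|].
by case: (forder _ _) => [|[|[|m]]] // _ /dvdn_leq; lia.
Qed.

Lemma card_intertwiners_shift j k :
  #|intertwiners (shift j) (shift k)| =
    if gcdn n k == gcdn n j then
      ((n %/ gcdn n j) ^ gcdn n j * (gcdn n j)`!)%N else 0%N.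
Proof.
case: eqP => [eq_g|neq_g].
  rewrite (card_intertwiners (m := n %/ gcdn n j)) ?card_ord ?divnA ?dvdn_gcdl //;
  by rewrite ?mulKn //; do ?[exact: shift_inj | move=> x; rewrite order_shift ?eq_g].
apply/eqP; rewrite cards_eq0; apply/eqP/setP => s; rewrite in_set0.
apply/negP => sP; apply: neq_g.
have := order_intertwiner 0 (@shift_inj j) (@shift_inj k) sP.
rewrite !order_shift => eq_q.
have gk := dvdn_gcdl n k; have gj := dvdn_gcdl n j.
have q0 : (0 < n %/ gcdn n j)%N by rewrite divn_gt0 ?gcdn_gt0 // dvdn_leq.
by apply/eqP; rewrite -(eqn_pmul2l q0) -{1}eq_q !divnK.
Qed.

(** All orbits of a shift have one length, so a matching reflection is fixed-point free, which
    happens exactly for n even and j odd. *)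
Lemma card_intertwiners_flip j k :
  #|intertwiners (flip j) (shift k)| =
    if [&& ~~ odd n, odd j & k == n./2 :> nat] then (2 ^ n./2 * (n./2)`!)%N
    else 0%N.
Proof.
case: ifP => [/and3P[evn odj /eqP kE]|cond].
  have gE : gcdn n k = n./2 by rewrite kE -{1}(even_halfK evn) -muln2 gcdnC gcdnMr.
  have qE : (n %/ n./2 = 2)%N by rewrite -{1}(even_halfK evn) -muln2 mulKn.
  rewrite (card_intertwiners (m := 2)) ?card_ord ?divn2 //.
  - exact: flip_inj.
  - exact: shift_inj.
  (* A fixed point would give j = 2x modulo the even n, against j odd. *)
  - move=> x; rewrite order_flip; case: eqP => // /eqP.
    rewrite subr_eq => /eqP/(congr1 val) /= jE; move: odj; rewrite jE.
    rewrite addnn odd_mod ?odd_double //; exact/negbTE.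
  - by move=> x; rewrite order_shift gE.
apply/eqP; rewrite cards_eq0; apply/eqP/setP => s; rewrite in_set0.
apply: contraFF cond => sP.
have ordE x : (n %/ gcdn n k = if flip j x == x then 1 else 2)%N.
  rewrite -order_flip -(order_intertwiner x (@flip_inj j) (@shift_inj k) sP).
  by rewrite order_shift.
(* One fixed point forces common order 1, so 0 and 1 are fixed too, giving j = 0 and -1 = 1. *)
have nfix x : flip j x != x.
  apply/negP => fx; have q1 := ordE x; rewrite fx in q1.
  move: (ordE 0) (ordE 1); rewrite q1 /flip subr0.
  case: eqP => // -> _; case: eqP => // /eqP.
  by rewrite sub0r -subr_eq0 -opprD oppr_eq0.
have := ordE 0; rewrite (negPf (nfix 0)) => q2.
have nE : n = (gcdn n k * 2)%N by rewrite -q2 mulnC divnK ?dvdn_gcdl.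
have evn : ~~ odd n by rewrite nE muln2 odd_double.
have gE : gcdn n k = n./2 by rewrite [in RHS]nE muln2 doubleK.
apply/and3P; split=> //.
(* For j even, j/2 would be a fixed point. *)
- apply: contraT => evj; case/negP: (nfix (inord j./2)).
  rewrite /flip subr_eq -val_eqE /= !inordK; last by have := ltn_ord j; lia.
  by rewrite addnn even_halfK // modn_small.
(* k is a multiple of n/2 below n, and k = 0 is excluded because its gcd with n is n. *)
- have := dvdn_gcdr n k; rewrite gE => /dvdnP[q kE].
  have := ltn_ord k; rewrite kE {2}nE gE mulnC ltn_pmul2l; last by lia.
  case: q kE => [|[|]] //= kE _; last by rewrite muln1.
  by move: gE; rewrite kE mul0n gcdn0; lia.
Qed.

End Translations.

(** * Summing the intertwiner counts over all pairs *)

Section FixedPointSums.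
Variable p : nat.
Local Notation n := p.+3.

Lemma sum_card_intertwiners_shift :
  \sum_(j < n) \sum_(k < n) #|intertwiners (@shift p j) (@shift p k)| =
  \sum_(d <- divisors n) totient (n %/ d) ^ 2 * (n %/ d) ^ d * d`!.
Proof.
pose c d := (n %/ d) ^ d * d`!.
(* One totient counts the k with the same gcd as j. Writing the result as a sum over d lets the
   exchange of sums count the j as well, which squares the totient. *)
have sumk (j : 'I_n) :
    \sum_(k < n) #|intertwiners (@shift p j) (@shift p k)| =
    \sum_(d <- divisors n | d == gcdn n j) totient (n %/ d) * c d.
  rewrite -big_filter filter_pred1_uniq ?divisors_uniq -?dvdn_divisors ?dvdn_gcdl //.
  rewrite big_seq1.
  rewrite -card_gcdn_eq ?dvdn_gcdl // -sum_nat_cond_const [RHS]big_mkcond.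
  by apply: eq_bigr => k _; rewrite card_intertwiners_shift.
rewrite (eq_bigr _ (fun j _ => sumk j)) (exchange_big_dep xpredT) //=.
rewrite big_seq [RHS]big_seq; apply: eq_bigr => d; rewrite -dvdn_divisors // => dn.
under eq_bigl => j do rewrite eq_sym.
by rewrite sum_nat_cond_const card_gcdn_eq // /c !mulnA.
Qed.

Lemma sum_card_intertwiners_flip :
  \sum_(j < n) \sum_(k < n) #|intertwiners (@flip p j) (@shift p k)| =
  if odd n then 0 else n./2 * double_factorial n.
Proof.
under eq_bigr => j _ do under eq_bigr => k _ do rewrite card_intertwiners_flip.
case: ifPn => [odn|evn]; first by rewrite big1 // => j _; rewrite big1.
rewrite double_factorial_even // -[X in _ = X * _]card_odd_ord //.
rewrite -sum_nat_cond_const [RHS]big_mkcond.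
apply: eq_bigr => j _ /=.
have hlt : n./2 < n by lia.
rewrite (bigD1 (Ordinal hlt)) //= eqxx andbT.
case: (odd j); rewrite big1 ?addn0 // => k.
by rewrite -val_eqE /= => /negPf ->.
Qed.
End FixedPointSums.

(** * The action of dihedral group times rotations on permutations, and Burnside's lemma *)

Section DihedralRotationAction.
Variable p : nat.
Local Notation n := p.+3.
Implicit Types (j k x : 'I_n) (s t : 'S_n).

Definition rho k : 'S_n := perm (@shift_inj p k).
Definition tau j : 'S_n := perm (@flip_inj p j).

Lemma rhoE k x : rho k x = (x + k)%R. Proof. by rewrite permE. Qed.
Lemma tauE j x : tau j x = (j - x)%R. Proof. by rewrite permE. Qed.

Lemma rho_inj : injective rho.
Proof. by move=> k l /permP/(_ 0%R); rewrite !rhoE !add0r. Qed.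

Lemma tau_inj : injective tau.
Proof. by move=> k l /permP/(_ 0%R); rewrite !tauE !subr0. Qed.

(** Agreement at 0 gives j = k, and then agreement at 1 gives -1 = 1. *)
Lemma tau_neq_rho j k : tau j != rho k.
Proof.
apply/eqP => /permP eq_jk.
move: (eq_jk 0%R) (eq_jk 1%R); rewrite !tauE !rhoE subr0 add0r addrC => -> /addIr.
by move/eqP; rewrite -subr_eq0 -opprD oppr_eq0.
Qed.

Lemma rho0 : rho 0%R = 1%g.
Proof. by apply/permP => x; rewrite rhoE addr0 perm1. Qed.

Lemma rhoM k l : (rho k * rho l)%g = rho (k + l)%R.
Proof. by apply/permP => x; rewrite permM !rhoE addrA. Qed.

Lemma tau_rhoM j k : (tau j * rho k)%g = tau (j + k)%R.
Proof. by apply/permP => x; rewrite permM rhoE !tauE addrAC. Qed.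

Lemma rho_tauM j k : (rho k * tau j)%g = tau (j - k)%R.
Proof.
by apply/permP => x; rewrite permM rhoE !tauE opprD [(-x - k)%R]addrC addrA.
Qed.

Lemma tauM i j : (tau i * tau j)%g = rho (j - i)%R.
Proof.
apply/permP => x; rewrite permM rhoE !tauE opprB addrC -addrA.
by rewrite [(-i + j)%R]addrC.
Qed.

Definition rotations : {set 'S_n} := [set rho k | k : 'I_n].
Definition dihedral : {set 'S_n} := rotations :|: [set tau j | j : 'I_n].

Lemma mem_rho k : rho k \in rotations. Proof. exact: imset_f. Qed.
Lemma mem_rho_dihedral k : rho k \in dihedral.
Proof. by rewrite inE mem_rho. Qed.
Lemma mem_tau_dihedral j : tau j \in dihedral.
Proof. by rewrite inE imset_f ?orbT. Qed.

Lemma dihedralP a :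
  reflect ((exists k, a = rho k) \/ (exists j, a = tau j)) (a \in dihedral).
Proof.
apply: (iffP setUP) => [[] /imsetP[k _ ->]|[] [k ->]].
- by left; exists k.
- by right; exists k.
- by left; apply: imset_f.
- by right; apply: imset_f.
Qed.

Lemma group_set_rotations : group_set rotations.
Proof.
apply/group_setP; split=> [|_ _ /imsetP[k _ ->] /imsetP[l _ ->]].
  by rewrite -rho0 mem_rho.
by rewrite rhoM mem_rho.
Qed.
Canonical rotations_group := Group group_set_rotations.

Lemma group_set_dihedral : group_set dihedral.
Proof.
apply/group_setP; split=> [|_ _ /dihedralP[] [k ->] /dihedralP[] [l ->]].
- by rewrite -rho0 mem_rho_dihedral.
- by rewrite rhoM mem_rho_dihedral.
- by rewrite rho_tauM mem_tau_dihedral.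
- by rewrite tau_rhoM mem_tau_dihedral.
- by rewrite tauM mem_rho_dihedral.
Qed.
Canonical dihedral_group := Group group_set_dihedral.

Lemma disjoint_rotations_tau : [disjoint rotations & [set tau j | j : 'I_n]].
Proof.
apply/pred0P => a /=; apply/negP => /andP[/imsetP[k _ ->] /imsetP[j _ /eqP]].
by rewrite eq_sym (negPf (tau_neq_rho _ _)).
Qed.

Lemma big_rotations (F : 'S_n -> nat) :
  \sum_(a in rotations) F a = \sum_k F (rho k).
Proof. by rewrite big_imset //= => k l _ _ /rho_inj. Qed.

Lemma big_dihedral (F : 'S_n -> nat) :
  \sum_(a in dihedral) F a = \sum_k F (rho k) + \sum_j F (tau j).
Proof.
rewrite (eq_bigl _ _ (fun a => in_setU a rotations _)).
rewrite bigU ?disjoint_rotations_tau //= big_rotations; congr (_ + _).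
by rewrite big_imset //= => k l _ _ /tau_inj.
Qed.

Lemma card_rotations : #|rotations| = n.
Proof. by rewrite card_imset ?card_ord //; apply: rho_inj. Qed.

Lemma card_dihedral : #|dihedral| = n.*2.
Proof. by rewrite -sum1_card big_dihedral !sum1_card card_ord addnn. Qed.

(** The inverse on the left factor makes this a right action of the product group. *)
Definition biact s (a : 'S_n * 'S_n) : 'S_n := (a.1^-1 * s * a.2)%g.

Lemma biact1 : biact^~ 1%g =1 id.
Proof. by move=> s; rewrite /biact invg1 mul1g mulg1. Qed.

Lemma biactM s : act_morph biact s.
Proof. by move=> a b; rewrite /biact /= invMg !mulgA. Qed.

Canonical biaction := TotalAction biact1 biactM.

(** Permutations compose from left to right, so [a * s = s * b] says that [s (a x) = b (s x)] for
    all x. *)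
Lemma fix_biaction a b : ('Fix_biaction[(a, b)])%g = intertwiners a b.
Proof.
apply/setP => s; apply/afix1P/intertwinersP => [fix_s x|comm_s].
  move/permP/(_ (a x)): fix_s; rewrite /= /biact /= !permM permK.
  exact: esym.
by apply/permP => x; rewrite /= /biact /= !permM -comm_s permKV.
Qed.

Lemma eq_intertwiners (f f' g g' : 'I_n -> 'I_n) :
  f =1 f' -> g =1 g' -> intertwiners f g = intertwiners f' g'.
Proof.
move=> eq_f eq_g; apply/setP => s.
by apply/intertwinersP/intertwinersP => fgs x; have := fgs x; rewrite eq_f eq_g.
Qed.

Definition symmetries := setX_group dihedral_group rotations_group.

Lemma card_biaction_orbits :
  #|orbit biaction symmetries @: setT| * (n.*2 * n) =
  \sum_(d <- divisors n) totient (n %/ d) ^ 2 * (n %/ d) ^ d * d`! +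
  (if odd n then 0 else n./2 * double_factorial n).
Proof.
have <- : #|symmetries| = n.*2 * n.
  by rewrite cardsX card_dihedral card_rotations.
rewrite -Frobenius_Cauchy; last by apply/actsP => a _ s; rewrite !inE.
transitivity (\sum_(a in dihedral) \sum_(b in rotations) #|intertwiners a b|).
  rewrite pair_big /=; apply: eq_big => [[a b]|[a b] _]; first by rewrite in_setX.
  by rewrite setTI fix_biaction.
(* Rotations in the dihedral factor yield the divisor sum, reflections the double factorial term. *)
rewrite big_dihedral -sum_card_intertwiners_shift -sum_card_intertwiners_flip.
congr (_ + _); apply: eq_bigr => j _; rewrite big_rotations; apply: eq_bigr => k _.
  by congr #|pred_of_set _|; apply: eq_intertwiners => x; rewrite permE.
by congr #|pred_of_set _|; apply: eq_intertwiners => x; rewrite permE.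
Qed.

End DihedralRotationAction.

(** * Hamiltonian subgraphs as classes of permutations *)

Lemma next_iota m i : i < m -> next (iota 0 m) i = i.+1 %% m.
Proof.
case: m => // m ltim.
have idx : index i (iota 0 m.+1) = i.
  have := index_uniq 0 (s := iota 0 m.+1) (i := i).
  by rewrite size_iota iota_uniq nth_iota // add0n; apply.
rewrite next_nth mem_iota add0n ltim idx /=; have [lt_im|le_mi] := ltnP i m.
  by rewrite nth_iota // modn_small.
(* At the last entry, [nth] runs past the tail and returns its default, the head 0, which is the
   cyclic successor. *)
have -> : i = m by lia.
by rewrite nth_default ?size_iota // modnn.
Qed.

Section HamiltonianSubgraphs.
Variable p : nat.
Local Notation n := p.+3.
Implicit Types (j k x : 'I_n) (s t : 'S_n).
Local Open Scope ring_scope.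

Lemma next_enum_ord (i : 'I_n) : next (enum 'I_n) i = i + 1.
Proof.
apply: val_inj; rewrite -(next_map val_inj) ?enum_uniq //.
rewrite val_enum_ord next_iota ?ltn_ord //.
by rewrite -[in LHS]addn1.
Qed.

Definition ham_subgraph s : subgraph n :=
  ([set: 'I_n], [set [set s i; s (i + 1)] | i : 'I_n]).

Lemma cycle_subgraph_perm s :
  cycle_subgraph [seq s i | i <- enum 'I_n] = ham_subgraph s.
Proof.
congr pair; first by apply/setP => x; rewrite !inE -[x](permKV s) map_f ?mem_enum.
apply/setP => e; apply/imsetP/imsetP => [[x _ ->]|[i _ ->]].
  exists (s^-1 x)%g => //; rewrite -[x in LHS](permKV s) next_map ?enum_uniq //.
    by rewrite next_enum_ord permKV.
  exact: perm_inj.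
exists (s i); first by rewrite map_f ?mem_enum.
by rewrite next_map ?enum_uniq ?next_enum_ord //; apply: perm_inj.
Qed.

(** A duplicate-free n-tuple over ['I_n] lists the values of a permutation; conversely consecutive
    values differ, hence are adjacent in K_n. *)
Lemma hamiltonian_subgraphsE : hamiltonian_subgraphs n = ham_subgraph @: setT.
Proof.
apply/setP => G; apply/imsetP/imsetP => [[t]|[s _ ->]].
  rewrite inE => /andP[/andP[_ Ut] _] ->.
  have injt : injective (tnth t) by apply/tuple_uniqP.
  exists (perm injt) => //; rewrite -cycle_subgraph_perm; congr cycle_subgraph.
  rewrite -{1}(map_tnth_enum t); apply: eq_map => i; by rewrite permE.
exists [tuple s i | i < n]; last by rewrite -cycle_subgraph_perm.
have Ut : uniq [seq s i | i <- enum 'I_n].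
  by rewrite map_inj_uniq ?enum_uniq //; apply: perm_inj.
have in_t x : x \in [seq s i | i <- enum 'I_n].
  by rewrite -[x](permKV s) map_f ?mem_enum.
rewrite inE; apply/andP; split; last by apply/forallP => x; apply: in_t.
apply/andP; split; last exact: Ut.
apply: (cycle_from_next Ut) => x _; rewrite -[x](permKV s).
rewrite next_map ?enum_uniq //; last exact: perm_inj.
rewrite next_enum_ord /Kn /= (inj_eq perm_inj) eq_sym.
by rewrite -subr_eq0 addrAC subrr add0r.
Qed.

Lemma rotvE k x : rotv k x = x + k.
Proof. exact: val_inj. Qed.

Lemma rot_ham k s :
  rot_subgraph k (ham_subgraph s) = ham_subgraph (s * rho k)%g.
Proof.
congr pair.
  apply/setP => x; rewrite inE; apply/imsetP; exists (x - k) => //.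
  by rewrite rotvE subrK.
rewrite -imset_comp; apply: eq_imset => i /=.
by rewrite imsetU !imset_set1 !permM !rhoE !rotvE.
Qed.

Lemma ham_dihedral a s :
  a \in dihedral p -> ham_subgraph (a * s)%g = ham_subgraph s.
Proof.
move=> aD; congr pair; apply/setP => e.
case/dihedralP: aD => [] [k ->]; apply/imsetP/imsetP => [] [i _ ->].
- by exists (i + k) => //; rewrite !permM !rhoE addrAC.
- by exists (i - k) => //; rewrite !permM !rhoE [_ + 1 + _]addrAC !subrK.
(* The reflection sends positions i, i+1 to k-i, k-i-1, so the edge is listed from its other end. *)
- exists (k - i - 1) => //.
  by rewrite !permM !tauE subrK setUC opprD addrA.
- exists (k - (i + 1)) => //.
  have stepk : k - (i + 1) + 1 = k - i by rewrite opprD addrA subrK.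
  by rewrite !permM !tauE stepk !subKr setUC.
Qed.

(** Here [u] sends a position in the listing [t] to the position of the same vertex in the listing
    [s]. *)
Lemma eq_ham_dihedral s t :
  ham_subgraph s = ham_subgraph t -> (t * s^-1)%g \in dihedral p.
Proof.
case=> eqE; set u := (t * s^-1)%g.
have stepE i : u (i + 1) = u i + 1 \/ u (i + 1) = u i - 1.
  have : [set t i; t (i + 1)] \in [set [set s i; s (i + 1)] | i : 'I_n].
    by rewrite eqE; apply/imsetP; exists i.
  case/imsetP => i' _ /setP eqi.
  have uE x : t x = s (u x) by rewrite permM permKV.
  have := eqi (t i); have := eqi (t (i + 1)).
  rewrite !inE !eqxx orbT /= !uE !(inj_eq perm_inj).
  have : u (i + 1) != u i.
    by rewrite (inj_eq perm_inj) -subr_eq0 addrAC subrr add0r.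
  move=> neq /esym/orP[] /eqP e1 /esym/orP[] /eqP e2; move: neq;
    rewrite e1 e2 ?eqxx // => _.
  - by right; rewrite addrK.
  - by left.
(* The walk cannot turn back: i + 2 differs from i since n is at least 3. *)
have turn i : u (i + 1 + 1) != u i.
  by rewrite (inj_eq perm_inj) -subr_eq0 -(addrA i) addrAC subrr add0r.
(* The first step fixes the direction for good; [c] is 1 for rotations and -1 for reflections. *)
have line (c : 'I_n) :
    (forall i, u (i + 1) = u i + c \/ u (i + 1) = u i - c) ->
  u (0 + 1) = u 0 + c -> forall x, u x = u 0 + c *+ x.
  move=> stepc u1 x.
  have step (m : nat) : u (m%:R + 1) = u m%:R + c.
    elim: m => [//|m IHm]; have [//|back] := stepc m.+1%:R.
    by case/eqP: (turn m%:R); rewrite -mulrSr back mulrSr IHm addrK.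
  rewrite -[X in u X]natr_Zp; elim: (x : nat) => [|m IHm]; first by rewrite addr0.
  by rewrite mulrSr step IHm mulrSr addrA.
have [u1|u1] := stepE 0; apply/dihedralP; [left|right]; exists (u 0).
  by apply/permP => x; rewrite rhoE (line 1 stepE u1 x) natr_Zp addrC.
have stepN i : u (i + 1) = u i + -1 \/ u (i + 1) = u i - -1.
  by rewrite opprK; case: (stepE i); auto.
by apply/permP => x; rewrite tauE (line _ stepN u1 x) mulNrn natr_Zp.
Qed.

Lemma rot_equiv_ham s t :
  rot_equiv (ham_subgraph s) (ham_subgraph t) =
  (t \in orbit (biaction p) (symmetries p) s).
Proof.
apply/existsP/orbitP => [[k /eqP]|[[a b] /setXP[/= aD /imsetP[k _ ->]] <-]].
  rewrite rot_ham => /esym/eq_ham_dihedral tD.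
  (* The first component solves a^-1 s [rho k] = t for a. *)
  exists ((t * (s * rho k)^-1)^-1, rho k)%g.
    by rewrite in_setX groupV tD mem_rho.
  by rewrite /= /biact /= invgK -mulgA mulgKV.
exists k; apply/eqP; rewrite rot_ham /= /biact /= -mulgA ham_dihedral //.
by rewrite groupV.
Qed.

(** Taking preimages under [ham_subgraph] turns rotation classes into orbits. *)
Lemma card_rot_classes :
  #|equivalence_partition (@rot_equiv n) (hamiltonian_subgraphs n)| =
  #|orbit (biaction p) (symmetries p) @: setT|.
Proof.
rewrite hamiltonian_subgraphsE; set R := @rot_equiv n.
set H := ham_subgraph @: setT.
have subH B : B \in equivalence_partition R H -> B \subset H.
  by case/imsetP=> G _ ->; apply/subsetP => G'; rewrite inE => /andP[].
pose pre (B : {set subgraph n}) := ham_subgraph @^-1: B.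
rewrite -(@card_in_imset _ _ pre) => [|A B PA PB eqAB].
  apply: eq_card => O; apply/imsetP/imsetP => [|[s _ ->]].
    case=> B /imsetP[_ /imsetP[s _ ->] ->] ->.
    by exists s => //; apply/setP => t; rewrite !inE imset_f ?inE //= -rot_equiv_ham.
  exists [set G in H | R (ham_subgraph s) G]; first by rewrite imset_f // imset_f.
  by apply/setP => t; rewrite !inE imset_f ?inE //= -rot_equiv_ham.
(* A class lies in the image of [ham_subgraph], so its preimage determines it. *)
have mem_pre C G : C \in equivalence_partition R H ->
    (G \in C) = [exists s, (ham_subgraph s == G) && (s \in pre C)].
  move=> PC; apply/idP/existsP => [CG|[s /andP[/eqP <-]]]; last by rewrite inE.
  have /imsetP[s _ defG] := subsetP (subH _ PC) _ CG.
  by exists s; rewrite inE -defG eqxx.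
by apply/setP => G; rewrite !mem_pre // eqAB.
Qed.

End HamiltonianSubgraphs.

(** * The closed formula over the rationals *)

Local Open Scope ring_scope.

Theorem theorem9 (n : nat) (hn : (3 <= n)%N) :
  #|equivalence_partition (@rot_equiv n) (hamiltonian_subgraphs n)|%:R =
    1 / (2 * n%:R ^+ 2) *
    (\sum_(d <- divisors n)
        (totient (n %/ d))%:R ^+ 2 * (n %/ d)%:R ^+ d * d`!%:R
     + (if odd n then 0 else n%:R / 2 * (double_factorial n)%:R)) :> rat.
Proof.
case: n hn => [|[|[|p]]] // _; rewrite card_rot_classes.
have /(congr1 (fun m => m%:R : rat)) := card_biaction_orbits p.
have n0 : (2 * p.+3%:R ^+ 2 : rat) != 0.
  by rewrite mulf_neq0 ?expf_neq0 ?Num.Theory.pnatr_eq0.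
rewrite natrM -muln2 mulnAC !natrM => orbE.
apply: (mulIf n0); rewrite mul1r mulrAC mulVf // mul1r.
rewrite expr2 [2 * _]mulrC orbE natrD natr_sum; congr (_ + _).
  by apply: eq_bigr => d _; rewrite !natrM !natrX.
case: ifPn => // evn; rewrite natrM; congr (_ * _).
(* For n even, the integer half [n./2] casts to the rational n/2. *)
by rewrite -[in RHS](even_halfK evn) -muln2 natrM mulfK.
Qed.
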